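(* Let $p>1$, let $G=(V,E)$ be a finite connected graph with vertex measure $\mu$ and symmetric edge measure $\omega$, and let $k\in C(V)$ satisfy $k_i>0$ for every $i\in V$. Consider the operator $L:C(V)\to C(V)$, $Lf=\Delta_p f-kf$. Then $L$ is one to one and onto. Moreover, $-L^{-1}$ preserves order, that is: for all $f,g\in C(V)$, if $-Lf\le -Lg$ on $V$, then $f\le g$ on $V$.
   Context: $G=(V,E)$ is a finite connected graph with vertex set $V$ and edge set $E$; $i\sim j$ means that $i,j\in V$ are joined by an edge. $\mu:V\to(0,+\infty)$ is a fixed vertex measure and $\omega:E\to(0,+\infty)$ is a fixed edge measure, symmetric: $\omega_{ij}=\omega_{ji}$ for each edge $i\sim j$. $C(V)$ is the finite-dimensional vector space of all real functions on $V$. For $p>1$ the discrete $p$-Laplacian $\Delta_p:C(V)\to C(V)$ is $$\Delta_p f_i=\frac{1}{\mu_i}\sum_{j\sim i}\omega_{ij}|f_j-f_i|^{p-2}(f_j-f_i),\qquad i\in V,$$ where $|t|^{p-2}t$ is understood to be $0$ at $t=0$. Here $kf$ denotes the pointwise product, and inequalities between functions are pointwise. *)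

(* Defs.v *)
From mathcomp Require Import all_boot all_order all_algebra.
From mathcomp Require Import all_classical all_reals all_analysis.
Set Implicit Arguments.
Unset Strict Implicit.
Unset Printing Implicit Defensive.
Import Order.TTheory GRing.Theory Num.Theory.
Local Open Scope ring_scope.

(* For t = 0 the factor [t] makes the product 0, whatever the value of
   [0 `^ (p - 2)]; this is the usual convention |t|^(p-2) t = 0 at t = 0. *)
Definition signed_pow (R : realType) (p t : R) : R := `|t| `^ (p - 2) * t.

(* The edge measure is a total function [w] on pairs of vertices; only its values
   on adjacent pairs are used. *)
Definition pLaplacian (R : realType) (V : finType) (e : rel V)
    (mu : V -> R) (w : V -> V -> R) (p : R) (f : {ffun V -> R}) :
    {ffun V -> R} :=
  [ffun i => (mu i)^-1 * \sum_(j | e i j) w i j * signed_pow p (f j - f i)].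

Definition pLaplacian_sub (R : realType) (V : finType) (e : rel V)
    (mu : V -> R) (w : V -> V -> R) (p : R) (k f : {ffun V -> R}) :
    {ffun V -> R} :=
  [ffun i => pLaplacian e mu w p f i - k i * f i].

(* Main.v *)
Require Import Defs.
From mathcomp Require Import all_boot all_order all_algebra.
From mathcomp Require Import all_classical all_reals all_analysis.
From mathcomp Require Import lra.
Set Implicit Arguments.
Unset Strict Implicit.
Unset Printing Implicit Defensive.
Import Order.TTheory GRing.Theory Num.Theory.
Import numFieldNormedType.Exports.
Local Open Scope ring_scope.

(** Both halves rest on one monotonicity property of the p-Laplacian: if
    [f j - f i <= g j - g i] for all [j], then [Delta_p f i <= Delta_p g i]
    ([le_pLaplacian]), because [t |-> |t|^(p-2) t] is increasing.

    Comparison ([pLaplacian_sub_comparison]): at a vertex [i] where [f - g] is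
    maximal this gives [Delta_p f i <= Delta_p g i], so that [- L f i <= - L g i]
    forces [k i * f i <= k i * g i]; hence [f <= g] at [i], and then everywhere.
    Injectivity follows at once.

    Surjectivity is obtained by the method of Perron ([perron_method]) rather
    than by minimising an energy.  To solve [- L u = c], take for [u] the
    pointwise supremum of the subsolutions, i.e. of the [f] with [- L f <= c].
    Large constants [M] and [- M] are a super- and a subsolution, so by
    comparison this supremum is finite.  Since [- L f i] can only decrease when
    the values of [f] away from [i] increase, and is continuous in [f i], the
    supremum [u] is itself a subsolution; and if the inequality were strict at
    some [i], the value [u i] alone could be raised a little, against the
    definition of [u].  The continuity needed here is that of
    [t |-> |t|^(p-2) t], including at 0 when [p < 2]; it holds because this map
    is increasing and onto. *)

(** * The function |t|^(p-2) t *)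

Section SignedPow.
Variables (R : realType) (p : R).
Hypothesis hp : 1 < p.

Lemma signed_pow0 : signed_pow p 0 = 0.
Proof. by rewrite /signed_pow mulr0. Qed.

Lemma signed_powN t : signed_pow p (- t) = - signed_pow p t.
Proof. by rewrite /signed_pow normrN mulrN. Qed.

Lemma ge0_signed_powE t : 0 <= t -> signed_pow p t = t `^ (p - 1).
Proof.
move=> t0; rewrite /signed_pow ger0_norm// mulrC.
rewrite -[RHS]mulr_powRB1// ?subr_gt0//.
by congr (_ * _ `^ _); lra.
Qed.

Lemma signed_pow_gt0 t : 0 < t -> 0 < signed_pow p t.
Proof. by move=> t0; rewrite ge0_signed_powE ?ltW// powR_gt0. Qed.

Lemma signed_pow_ge0_homo s t :
  0 <= s -> s < t -> signed_pow p s < signed_pow p t.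
Proof.
move=> s0 st; have t0 := le_trans s0 (ltW st).
rewrite !ge0_signed_powE//.
by apply: gt0_ltr_powR; rewrite ?nnegrE// subr_gt0.
Qed.

Lemma ltr_signed_pow : {mono signed_pow p : s t / s < t}.
Proof.
apply: leW_mono; apply: le_mono => s t st.
have [s0|s0] := leP 0 s; first exact: signed_pow_ge0_homo.
have [t0|t0] := leP t 0.
  by rewrite -ltrN2 -!signed_powN signed_pow_ge0_homo// ?ltrN2// oppr_ge0.
apply: (@lt_trans _ _ 0); last exact: signed_pow_gt0.
by rewrite -oppr_gt0 -signed_powN signed_pow_gt0// oppr_gt0.
Qed.

Lemma ler_signed_pow : {mono signed_pow p : s t / s <= t}.
Proof. by move=> s t; rewrite !leNgt ltr_signed_pow. Qed.

Lemma signed_pow_surj y : exists x, signed_pow p x = y.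
Proof.
wlog y0 : y / 0 <= y.
  move=> H; have [/H//|y0] := leP 0 y.
  have [|x xy] := H (- y); first by rewrite oppr_ge0 ltW.
  by exists (- x); rewrite signed_powN xy opprK.
exists (y `^ (p - 1)^-1).
rewrite ge0_signed_powE ?powR_ge0// -powRrM mulVf ?powRr1//.
by rewrite subr_eq0 gt_eqF.
Qed.

(** An increasing surjection of the line is continuous; no separate treatment
    of the origin is needed, where for [p < 2] the map is not differentiable. *)
Lemma continuous_signed_pow : continuous (signed_pow p).
Proof.
move=> x; apply/cvgrPdist_lt => eps eps0.
have [a aE] := signed_pow_surj (signed_pow p x - eps).
have [b bE] := signed_pow_surj (signed_pow p x + eps).
have xab : x \in `]a, b[.
  by rewrite in_itv/= -(ltr_signed_pow a) -(ltr_signed_pow x) aE bE;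
    apply/andP; split; lra.
apply: filterS (near_in_itvoo xab) => y.
rewrite in_itv/= -(ltr_signed_pow a) -(ltr_signed_pow y) aE bE => /andP[ay yb].
by rewrite ltr_norml; apply/andP; split; lra.
Qed.

End SignedPow.

(** * The method of Perron on a finite set *)

(** [f] with its value at [i] replaced by [t]. *)
Definition update (R : realType) (V : finType) (f : {ffun V -> R}) (i : V)
  (t : R) : {ffun V -> R} := [ffun j => if j == i then t else f j].

(** If [F f i] is nonincreasing in the values of [f] off [i] and continuous in
    [f i], and if the subsolutions of [F u = c] form a nonempty family bounded
    above, then their pointwise supremum is a solution. *)
Lemma perron_method (R : realType) (V : finType)
    (F : {ffun V -> R} -> {ffun V -> R}) (c a b : {ffun V -> R}) :
  (forall (f g : {ffun V -> R}) i,
     f i = g i -> (forall j, f j <= g j) -> F g i <= F f i) ->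
  (forall f i, continuous (fun t => F (update f i t) i)) ->
  (forall i, F a i <= c i) ->
  (forall f : {ffun V -> R},
     (forall i, F f i <= c i) -> forall i, f i <= b i) ->
  exists u, F u = c.
Proof.
move=> Fmono Fcont Fa Fb.
pose E i := [set f i | f in [set f : {ffun V -> R} |
                              forall j, F f j <= c j]]%classic.
have Esup i : has_sup (E i).
  split; first by exists (a i), a.
  by exists (b i) => _ [f /= Ff <-]; exact: Fb.
pose u : {ffun V -> R} := [ffun i => sup (E i)].
have u_ub (f : {ffun V -> R}) i : (forall j, F f j <= c j) -> f i <= u i.
  move=> Ff; rewrite ffunE; apply: ub_le_sup; first exact: (Esup i).2.
  by exists f.
have updateK i : update u i (u i) = u.
  by apply/ffunP => j; rewrite ffunE; case: eqP => [->|].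
have u_sub i : F u i <= c i.
  rewrite leNgt; apply/negP => cu.
  (* A subsolution [f] with [f i] close to [u i] would have
     [c i < F (update u i (f i)) i <= F f i], as [f <= u]. *)
  have /= := Fcont u i (u i); rewrite /continuous_at updateK.
  move=> /cvgr_gt /(_ _ cu) /nbhs_ex[d near_u].
  have [_ [f /= Ff <-]] := sup_adherent (gt0 d) (Esup i).
  have fu := u_ub f i Ff.
  have -> : sup (E i) = u i by rewrite ffunE.
  move=> uf; have /near_u : ball (u i) d%:num (f i).
    by rewrite /ball/= ltr_norml; apply/andP; split; lra.
  apply/negP; rewrite -leNgt; apply: le_trans (Ff i).
  apply: Fmono => [|j]; rewrite ffunE ?eqxx//.
  by case: eqP => [->//|_]; exact: u_ub.
exists u; apply/ffunP => i; apply/eqP; rewrite eq_le u_sub/= leNgt.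
apply/negP => uc.
(* [u] with its value at [i] raised by [d / 2] is still a subsolution: at [i] by
   continuity, elsewhere because [F] decreases there. *)
have /= := Fcont u i (u i); rewrite /continuous_at updateK.
move=> /cvgr_lt /(_ _ uc) /nbhs_ex[d near_u].
pose t := u i + d%:num / 2.
have d0 : 0 < d%:num by [].
have /near_u Ft : ball (u i) d%:num t.
  by rewrite /ball/= /t ltr_norml; apply/andP; split; lra.
have : update u i t i <= u i.
  apply: u_ub => j; have [->|ji] := eqVneq j i; first exact: ltW.
  apply: le_trans (u_sub j); apply: Fmono => [|l]; rewrite [update _ _ _ _]ffunE.
    by rewrite (negPf ji).
  by case: eqP => [->|//]; rewrite /t; lra.
by rewrite ffunE eqxx /t; lra.
Qed.

(** * The p-Laplacian *)

Section PLaplacian.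
Variables (R : realType) (p : R) (V : finType) (e : rel V).
Variables (mu : V -> R) (w : V -> V -> R) (k : {ffun V -> R}).
Hypotheses (hp : 1 < p) (mu_gt0 : forall i, 0 < mu i).
Hypothesis w_gt0 : forall i j, e i j -> 0 < w i j.
Hypothesis k_gt0 : forall i, 0 < k i.
Local Notation Lap := (pLaplacian e mu w p).
Local Notation L := (pLaplacian_sub e mu w p k).

Lemma le_pLaplacian (f g : {ffun V -> R}) i :
  (forall j, f j - f i <= g j - g i) -> Lap f i <= Lap g i.
Proof.
move=> fg; rewrite !ffunE ler_pM2l ?invr_gt0//.
by apply: ler_sum => j eij; rewrite ler_pM2l ?w_gt0// ler_signed_pow.
Qed.

Lemma pLaplacian_cst (M : R) i : Lap [ffun=> M] i = 0.
Proof.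
rewrite ffunE big1 ?mulr0// => j _.
by rewrite !ffunE subrr signed_pow0 mulr0.
Qed.

Lemma pLaplacian_sub_comparison (f g : {ffun V -> R}) :
  (forall i, - L f i <= - L g i) -> forall i, f i <= g i.
Proof.
move=> Lfg i0.
case: (@arg_maxP _ _ _ i0 predT (fun i => f i - g i)) => // i _ imax.
have lap : Lap f i <= Lap g i.
  by apply: le_pLaplacian => j; have := imax j isT => /=; lra.
have fgi : f i <= g i.
  rewrite -(ler_pM2l (k_gt0 i)).
  by have := Lfg i; rewrite ![L _ _]ffunE; lra.
by have := imax i0 isT => /=; lra.
Qed.

Lemma pLaplacian_sub_inj : injective L.
Proof.
move=> f g Lfg; apply/ffunP => i; apply/eqP; rewrite eq_le.
by rewrite !pLaplacian_sub_comparison// => j; rewrite Lfg.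
Qed.

Lemma continuous_pLaplacian_sub_update (f : {ffun V -> R}) i :
  continuous (fun t => L (update f i t) i).
Proof.
have -> : (fun t => L (update f i t) i) = (fun t =>
    (mu i)^-1 * (\sum_(j | e i j)
      w i j * signed_pow p ((if j == i then t else f j) - t)) - k i * t).
  apply/funext => t; rewrite !ffunE eqxx; congr (_ * _ - _).
  by apply: eq_bigr => j _; rewrite !ffunE.
move=> t; apply: cvgB; apply: cvgM; try exact: cvg_cst; last exact: cvg_id.
apply: cvg_big => [|j _]; first exact: add_continuous.
apply: cvgM; first exact: cvg_cst.
apply: (@cvg_comp _ _ _ (fun t => (if j == i then t else f j) - t)
  (signed_pow p)); last exact: continuous_signed_pow.
by apply: cvgB; [case: eqP => _; [exact: cvg_id|exact: cvg_cst]|exact: cvg_id].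
Qed.

Lemma pLaplacian_sub_surj (h : {ffun V -> R}) : exists f, L f = h.
Proof.
pose F (f : {ffun V -> R}) : {ffun V -> R} := - L f.
have FE f i : F f i = - L f i by rewrite ffunE.
(* [M * k i >= |h i|] for every [i] *)
pose M := \sum_i `|h i| / k i.
have hM i : `|h i| <= k i * M.
  rewrite mulrC -ler_pdivrMr// /M (bigD1 i)//= lerDl.
  by apply: sumr_ge0 => j _; rewrite divr_ge0// ltW.
have FM (x : R) i : F [ffun=> x] i = k i * x.
  by rewrite FE ffunE pLaplacian_cst ffunE sub0r opprK.
suff [u Fu] : exists u, F u = - h by exists u; exact: oppr_inj.
apply: (@perron_method _ _ F _ [ffun=> - M] [ffun=> M]).
- move=> f g i fgi fg; rewrite !FE lerN2 ![L _ _]ffunE fgi lerB//.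
  by apply: le_pLaplacian => j; rewrite fgi lerD2r.
- move=> f i.
  have -> : (fun t => F (update f i t) i) = (fun t => - L (update f i t) i).
    by apply/funext => t; exact: FE.
  by move=> t; apply: cvgN; exact: continuous_pLaplacian_sub_update.
- move=> i; rewrite FM mulrN ffunE lerN2.
  exact: le_trans (ler_norm _) (hM i).
- move=> f Ff; apply: pLaplacian_sub_comparison => i.
  rewrite -!FE FM; apply: le_trans (Ff i) _.
  by rewrite ffunE; apply: le_trans (hM i); rewrite -normrN ler_norm.
Qed.

End PLaplacian.

Theorem theorem2p1 (R : realType) (p : R) (hp : 1 < p)
    (V : finType) (e : rel V) (e_sym : symmetric e)
    (e_conn : forall i j : V, connect e i j)
    (mu : V -> R) (mu_gt0 : forall i, 0 < mu i)
    (w : V -> V -> R) (w_gt0 : forall i j, e i j -> 0 < w i j)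
    (w_sym : forall i j, e i j -> w i j = w j i)
    (k : {ffun V -> R}) (k_gt0 : forall i, 0 < k i) :
  let L := pLaplacian_sub e mu w p k in
  [/\ injective L,
      (forall h : {ffun V -> R}, exists f : {ffun V -> R}, L f = h)
    & (forall f g : {ffun V -> R},
        (forall i, - L f i <= - L g i) -> (forall i, f i <= g i))].
Proof.
split.
- exact: pLaplacian_sub_inj.
- exact: pLaplacian_sub_surj.
- exact: pLaplacian_sub_comparison.
Qed.
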